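(* Let $\mathcal{L},\mathcal{L}'\subseteq\mathbb{S}^n$ be Jordan spaces of the same dimension $m$. If $\mathcal{L}$ degenerates to $\mathcal{L}'$, then $\tau_k(\mathcal{L}')\leq\tau_k(\mathcal{L})$ for all $1\leq k\leq m$.
   Context: $\mathbb{S}^n$ is the space of complex symmetric $n\times n$ matrices. A Jordan space $\mathcal{L}\subseteq\mathbb{S}^n$ is a linear subspace containing an invertible matrix $U$ and closed under $X\bullet_UY=\frac12(XU^{-1}Y+YU^{-1}X)$. Degeneration of Jordan spaces: if $\mathcal{L},\mathcal{L}'\subseteq\mathbb{S}^n$ are Jordan spaces of dimension $m$ with bases $X_1,\dots,X_m$ and $X_1',\dots,X_m'$, then $\mathcal{L}$ degenerates to $\mathcal{L}'$ if there exist $P\in\mathrm{GL}_n(\mathbb{C}[t^{\pm1}])$ and $Q\in\mathrm{GL}_m(\mathbb{C}[t^{\pm1}])$ such that the entries of $(Y_1,\dots,Y_m):=(PX_1P^\top,\dots,PX_mP^\top)Q$ are matrices with coefficients in $\mathbb{C}[t]$ and $X_i'=\lim_{t\to0}Y_i$ for all $i$. For $1\le k\le m$, with $\mathrm{Gr}(k,\mathcal{L})$ the set of $k$-dimensional subspaces of $\mathcal{L}$, $$\tau_k(\mathcal{L}):=\min\left\{\max\{\operatorname{rk}(X)\mid X\in\mathcal{P}\setminus\{0\}\}\;\middle|\;\mathcal{P}\in\mathrm{Gr}(k,\mathcal{L})\right\}.$$ *)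

(* Defs.v *)
From HB Require Import structures.
From mathcomp Require Import all_boot all_order all_algebra.
From mathcomp Require Import boolp classical_sets reals topology normedtype.
From mathcomp Require Import complex.

Set Implicit Arguments.
Unset Strict Implicit.
Unset Printing Implicit Defensive.

Import Order.TTheory GRing.Theory Num.Theory.
Import numFieldNormedType.Exports.

#[global] Open Scope ring_scope.
#[global] Open Scope complex_scope.
#[global] Open Scope classical_set_scope.

(* The definitions are over a numClosedFieldType C, to be instantiated with R[i]
   for R : realType: its topology is then the usual one of the complex plane. *)

Section JordanSpaces.
Context {C : numClosedFieldType} {n : nat}.
Implicit Types (L : {vspace 'M[C]_n}) (U X Y : 'M[C]_n).

Definition jordan_prod U X Y : 'M[C]_n :=
  2%:R^-1 *: (X *m invmx U *m Y + Y *m invmx U *m X).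

Definition jordan_space L : Prop :=
  (forall X, X \in L -> X^T = X) /\
  exists U, [/\ U \in L, U \in unitmx &
    forall X Y, X \in L -> Y \in L -> jordan_prod U X Y \in L].

End JordanSpaces.

(* The ring C[t^{+-1}], as the subring of the field C(t) formed by the
   fractions p / t^d. *)
Definition is_laurent {C : numClosedFieldType} (f : {fraction {poly C}}) : Prop :=
  exists (p : {poly C}) (d : nat), f = tofrac p / tofrac 'X^d.

(* Membership in GL_r(C[t^{+-1}]): the matrix and its inverse both have Laurent
   polynomial entries. *)
Definition laurent_GL {C : numClosedFieldType} {r : nat}
    (A : 'M[{fraction {poly C}}]_r) : Prop :=
  [/\ A \in unitmx, forall a b, is_laurent (A a b) &
      forall a b, is_laurent (invmx A a b)].

(* A constant matrix, resp. a matrix over C[t], seen as a matrix over the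
   field C(t). *)
Definition cst_mx {C : numClosedFieldType} {n : nat} (A : 'M[C]_n) :
    'M[{fraction {poly C}}]_n :=
  map_mx (fun c => tofrac c%:P) A.

Definition poly_mx {C : numClosedFieldType} {n : nat} (A : 'M[{poly C}]_n) :
    'M[{fraction {poly C}}]_n :=
  map_mx (fun p => tofrac p) A.

(* The matrices Y i over C[t] are the entries of the row
   (P X_1 P^T, ..., P X_m P^T) Q. The choice of the two bases is immaterial:
   a change of basis over C can be absorbed in Q. *)
Definition degenerates {C : numClosedFieldType} {n : nat} (m : nat)
    (L L' : {vspace 'M[C]_n}) : Prop :=
  exists X X' : m.-tuple 'M[C]_n,
  [/\ basis_of L X, basis_of L' X' &
  exists (P : 'M[{fraction {poly C}}]_n)
         (Q : 'M[{fraction {poly C}}]_m)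
         (Y : 'I_m -> 'M[{poly C}]_n),
  [/\ laurent_GL P, laurent_GL Q,
      forall i, poly_mx (Y i) =
        \sum_(j < m) Q j i *: (P *m cst_mx (tnth X j) *m P^T) &
      forall i, map_mx (horner_eval t) (Y i) @[t --> (0 : C)^'] --> tnth X' i]].

(* Ranks are at most n, so the maximum and the minimum below range over the
   ordinals r < n.+1 that occur as values. *)
Definition max_rank {C : numClosedFieldType} {n : nat} (V : {vspace 'M[C]_n}) : nat :=
  (\max_(r < n.+1 | `[< exists X, [/\ X \in V, X != 0%R & \rank X = r] >]) r)%N.

Definition tau {C : numClosedFieldType} {n : nat} (k : nat)
    (L : {vspace 'M[C]_n}) : nat :=
  (\big[minn/n]_(r < n.+1 | `[< exists V : {vspace 'M[C]_n},
     [/\ (V <= L)%VS, \dim V = k & max_rank V = r] >]) r)%N.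

Lemma max_rank_ub (C : numClosedFieldType) (n : nat) (V : {vspace 'M[C]_n})
    (X : 'M[C]_n) :
  X \in V -> (\rank X <= max_rank V)%N.
Proof.
move=> XV; have [->|X0] := eqVneq X 0; first by rewrite mxrank0.
have rX : (\rank X < n.+1)%N by rewrite ltnS rank_leq_row.
rewrite /max_rank -[leqLHS]/(nat_of_ord (Ordinal rX)).
by apply: leq_bigmax_cond; apply/asboolP; exists X.
Qed.

Lemma max_rank_attained (C : numClosedFieldType) (n : nat) (V : {vspace 'M[C]_n}) :
  V != 0%VS -> exists X, [/\ X \in V, X != 0 & \rank X = max_rank V].
Proof.
move=> V0; rewrite /max_rank.
set S := [pred r : 'I_n.+1 |
  `[< exists X, [/\ X \in V, X != 0 & \rank X = r] >]].
have S0 : (0 < #|S|)%N.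
  have rX : (\rank (vpick V) < n.+1)%N by rewrite ltnS rank_leq_row.
  apply/card_gt0P; exists (Ordinal rX); apply/asboolP; exists (vpick V).
  by rewrite memv_pick vpick0.
have [r /asboolP[X [XV X0 rX]] Er] := eq_bigmax_cond (@nat_of_ord n.+1) S0.
by exists X; rewrite rX -Er.
Qed.

Lemma max_rank_le (C : numClosedFieldType) (n : nat) (V : {vspace 'M[C]_n}) :
  (max_rank V <= n)%N.
Proof. by apply/bigmax_leqP => r _; rewrite -ltnS. Qed.

Lemma tau_lb (C : numClosedFieldType) (n k : nat) (L V : {vspace 'M[C]_n}) :
  (V <= L)%VS -> \dim V = k -> (tau k L <= max_rank V)%N.
Proof.
move=> VL dV; have rV : (max_rank V < n.+1)%N by rewrite ltnS max_rank_le.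
rewrite /tau -minEnat -leEnat -[leRHS]/(nat_of_ord (Ordinal rV)).
by apply: bigmin_le_cond; apply/asboolP; exists V.
Qed.

Lemma tau_attained (C : numClosedFieldType) (n k : nat) (L : {vspace 'M[C]_n}) :
  (k <= \dim L)%N ->
  exists V, [/\ (V <= L)%VS, \dim V = k & max_rank V = tau k L].
Proof.
move=> kL.
have [V0 V0L dV0] : exists2 V, (V <= L)%VS & \dim V = k.
  have fL := basis_free (vbasisP L).
  exists <<take k (vbasis L)>>%VS.
    apply/span_subvP => v /mem_take; exact: vbasis_mem.
  have ft : free (take k (vbasis L)).
    by move: fL; rewrite -{1}(cat_take_drop k (vbasis L)) => /catl_free.
  by rewrite (eqP ft) size_takel // size_tuple.
have tn : (tau k L <= n)%N by exact: leq_trans (tau_lb V0L dV0) (max_rank_le _).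
suff : tau k L = n \/
    exists V, [/\ (V <= L)%VS, \dim V = k & max_rank V = tau k L].
  case=> // tE; exists V0; split=> //; apply/eqP.
  by rewrite eqn_leq (tau_lb V0L dV0) tE max_rank_le.
rewrite /tau.
pose good r := r = n \/
  exists V : {vspace 'M[C]_n}, [/\ (V <= L)%VS, \dim V = k & max_rank V = r].
apply: (big_ind good); first by left.
- by move=> x y gx gy; rewrite /minn; case: ifP.
- by move=> r /asboolP gr; right.
Qed.

(* Main.v *)
Require Import Defs.
From mathcomp Require Import all_boot all_order all_algebra.
From mathcomp Require Import boolp classical_sets reals topology normedtype.
From mathcomp Require Import complex.

Set Implicit Arguments.
Unset Strict Implicit.
Unset Printing Implicit Defensive.

Import Order.TTheory GRing.Theory Num.Theory.
Import numFieldNormedType.Exports.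

(** Let V be a subspace of L realising [tau k L], with basis v. Transporting V
    along the degeneration gives the C(t)-space spanned by the P v_b P^T, which
    is contained in the span of the Y_i; since the Y_i specialise at t = 0 to a
    basis of L', a k-dimensional limit of V inside L' should exist and, rank
    being lower semicontinuous, have no larger ranks than V.

    To make this precise, express t^d P v_b P^T through the Y_i by a k x m
    matrix D over C[t], of rank k over C(t) because Q is invertible. The rows of
    D may become dependent at t = 0; replacing the C[t]-module they span by its
    saturation at t ([saturation]) gives a matrix E with independent rows at
    t = 0 such that t^N E = A D. The space V' spanned by the combinations of the
    X'_i = Y_i(0) with coefficients E(0) then has dimension k.

    An element of V' is W(0), where W is a combination of the Y_i over C[t] and
    t^N W = t^d P G P^T with G a combination of v over C[t]. Both changes of
    scalars are controlled by minors: the rank of W(0) is at most the rank of W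
    over C(t) ([mxrank_horner_le]), and the rank of G over C(t) is reached at
    some value a of t ([mxrank_horner_generic]), where G(a) lies in V. Hence
    every element of V' has rank at most [max_rank V]. *)

Notation at_pt a := (map_mx (horner_eval a)).
Notation over_frac := (map_mx (@tofrac _)).

(** * Ranks of polynomial matrices and their values *)

Lemma exists_nonroot (F : numDomainType) (p : {poly F}) :
  p != 0 -> exists a, p.[a] != 0.
Proof.
move=> p0; have [//|noroot] := pselect (exists a, p.[a] != 0).
pose s : seq F := [seq i%:R | i <- iota 0 (size p)].
have us : uniq s by rewrite map_inj_uniq ?iota_uniq//; exact: mulrIn (oner_neq0 _).
have rs : all (root p) s.
  apply/allP => x _; apply/rootP/eqP/negPn/negP => px.
  by apply: noroot; exists x.
by have := max_poly_roots p0 rs us; rewrite size_map size_iota ltnn.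
Qed.

Lemma mxrank_minor (F : fieldType) m n (A : 'M[F]_(m, n)) :
  exists (f : 'I_(\rank A) -> 'I_m) (g : 'I_(\rank A) -> 'I_n),
    \det (mxsub f g A) != 0.
Proof.
pose B := rowsub (maxrankfun A) A.
have fB : row_full B^T by rewrite /row_full mxrank_tr; exact: maxrowsub_free.
exists (maxrankfun A), (fullrankfun fB).
have := fullrowsub_unit fB; rewrite unitmxE unitfE -det_tr.
by rewrite trmx_mxsub trmxK /B -mxsub_comp.
Qed.

Lemma minor_mxrank (F : fieldType) m n s (A : 'M[F]_(m, n))
    (f : 'I_s -> 'I_m) (g : 'I_s -> 'I_n) :
  \det (mxsub f g A) != 0 -> (s <= \rank A)%N.
Proof.
rewrite -unitfE -unitmxE => /mxrank_unit <-.
have -> : mxsub f g A = rowsub f (colsub g A) by rewrite -mxsub_comp.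
apply: leq_trans (mxrankS (rowsub_sub _ _)) _.
rewrite -mxrank_tr trmx_mxsub -(mxrank_tr A).
exact: mxrankS (rowsub_sub _ _).
Qed.

(** Specialisation can only lower the rank: a minor that does not vanish at a is
    a nonzero polynomial. *)
Lemma mxrank_horner_le (F : fieldType) m n (W : 'M[{poly F}]_(m, n)) (a : F) :
  (\rank (at_pt a W) <= \rank (over_frac W))%N.
Proof.
have [f [g]] := mxrank_minor (at_pt a W).
rewrite -map_mxsub det_map_mx => minor0; apply: (@minor_mxrank _ _ _ _ _ f g).
rewrite -map_mxsub det_map_mx tofrac_eq0.
by apply: contra_neq minor0 => ->; rewrite /= rmorph0.
Qed.

(** The rank over the function field is reached at some point, because a nonzero
    minor, being a polynomial over an infinite field, has a nonroot. *)
Lemma mxrank_horner_generic (F : numFieldType) m n (W : 'M[{poly F}]_(m, n)) :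
  exists a, (\rank (over_frac W) <= \rank (at_pt a W))%N.
Proof.
have [f [g]] := mxrank_minor (over_frac W).
rewrite -map_mxsub det_map_mx tofrac_eq0 => /exists_nonroot[a na].
exists a; apply: (@minor_mxrank _ _ _ _ _ f g).
by rewrite -map_mxsub det_map_mx.
Qed.

(** * Saturation of a lattice at the origin *)

(** A relation between the rows of D(0) yields a combination of the rows of D
    that is divisible by 'X; dividing it by 'X enlarges the module spanned by
    the rows. The matrix S records the division: its determinant 'X is what
    makes the process terminate. *)
Lemma saturation_step (F : fieldType) k m (D : 'M[{poly F}]_(k, m)) :
  ~~ row_free (at_pt 0 D) ->
  exists (A : 'M[{poly F}]_k) (S : 'M[{poly F}]_k) (G : 'M[F]_k)
    (E : 'M[{poly F}]_(k, m)),
  [/\ 'X *: E = A *m D, S *m E = map_mx polyC G *m D, \det S = 'X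
    & G \in unitmx].
Proof.
move=> nfree; set D0 := at_pt 0 D in nfree.
(* [invmx (col_ebase D0)] puts D0 in a form where the rows of index at least
   \rank D0 vanish, and i0 is the first of these. *)
have rk : (\rank D0 < k)%N by rewrite ltn_neqAle nfree rank_leq_row.
pose i0 := Ordinal rk; pose G := invmx (col_ebase D0).
pose GD := map_mx polyC G *m D.
have GD0 j : 'X %| GD i0 j.
  have -> : 'X = 'X - 0%:P :> {poly F} by rewrite subr0.
  rewrite dvdp_XsubCl; apply/rootP.
  have : (G *m D0) i0 j = 0.
    rewrite -[D0 in LHS]mulmx_ebase !mulmxA mulVmx ?col_ebase_unit// mul1mx.
    by rewrite mxE big1// => l _; rewrite mxE ltnn andbF mul0r.
  move=> GD0ij; rewrite -[RHS]GD0ij !mxE -horner_evalE rmorph_sum; apply: eq_bigr => l _.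
  by rewrite rmorphM /= !mxE /horner_eval hornerC.
pose d i : {poly F} := if i == i0 then 'X else 1.
pose E : 'M[{poly F}]_(k, m) := \matrix_(i, j) (GD i j %/ d i).
have dE i j : d i * E i j = GD i j.
  rewrite mxE /d mulrC; case: eqP => [->|_]; last by rewrite divp1 mulr1.
  by rewrite divpK.
exists (diag_mx (\row_i ('X %/ d i)) *m map_mx polyC G),
  (diag_mx (\row_i d i)), G, E; split.
- rewrite -mulmxA; apply/matrixP => i j.
  rewrite mul_diag_mx 2!mxE -/GD -dE mulrA !mxE; congr (_ * _).
  by rewrite /d; case: eqP => _; rewrite ?divp1 ?mulr1// divpp ?polyX_eq0 ?mul1r.
- by apply/matrixP => i j; rewrite mul_diag_mx mxE -/GD -dE [in LHS]mxE.
- rewrite det_diag (bigD1 i0)//= mxE /d eqxx big1 ?mulr1// => i /negPf ni.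
  by rewrite mxE ni.
- by rewrite unitmx_inv col_ebase_unit.
Qed.

(** Polynomial rows that are independent over the function field F(t) can be
    replaced by a polynomial basis of their F(t)-span that stays independent at
    t = 0. Each saturation step lowers
    by one the degree of a fixed nonzero maximal minor, so the process stops. *)
Lemma saturation (F : fieldType) k m (D : 'M[{poly F}]_(k, m)) :
  row_free (over_frac D) ->
  exists (N : nat) (A : 'M[{poly F}]_k) (E : 'M[{poly F}]_(k, m)),
    'X^N *: E = A *m D /\ row_free (at_pt 0 E).
Proof.
move=> freeD.
have [f] : exists f : 'I_k -> 'I_m, \det (colsub f D) != 0.
  have fullD : row_full (over_frac D)^T by rewrite /row_full mxrank_tr.
  exists (fullrankfun fullD); rewrite -tofrac_eq0 -det_map_mx map_mxsub.
  by rewrite -det_tr trmx_mxsub -unitfE -unitmxE fullrowsub_unit.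
move: (leqnn (size (\det (colsub f D)))).
move: {2}(size _) => s; elim: s D {freeD} => [|s IH] D sD nz.
  by move: nz; rewrite -size_poly_eq0 -leqn0 sD.
have [free0|nfree0] := boolP (row_free (at_pt 0 D)).
  by exists 0, 1%:M, D; rewrite expr0 scale1r mul1mx.
have [A [S [G [E [XE SE detS uG]]]]] := saturation_step nfree0.
have detE : 'X * \det (colsub f E) = (\det G)%:P * \det (colsub f D).
  rewrite -detS -det_map_mx -!det_mulmx.
  by rewrite !mulmx_colsub SE.
have detG : \det G != 0 by rewrite -unitfE -unitmxE.
have nzE : \det (colsub f E) != 0.
  apply: contra_neq nz => E0; move/eqP: detE.
  by rewrite E0 mulr0 eq_sym mulf_eq0 polyC_eq0 (negPf detG) => /eqP.
have sE : (size (\det (colsub f E)) <= s)%N.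
  have := congr1 (fun p : {poly F} => size p) detE.
  by rewrite mulrC size_mulX// mul_polyC size_scale// => sE; rewrite -ltnS sE.
have [N [A' [E' [XE' free']]]] := IH E sE nzE.
exists N.+1, (A' *m A), E'; split=> //.
by rewrite exprS -scalerA XE' -mulmxA -XE scalemxAr.
Qed.

(** * Laurent matrices and limits *)

Lemma laurent_common_denominator (C : numClosedFieldType) k m
    (D : 'M[{fraction {poly C}}]_(k, m)) :
  (forall i j, is_laurent (D i j)) ->
  exists (d : nat) (D' : 'M[{poly C}]_(k, m)),
    over_frac D' = tofrac 'X^d *: D.
Proof.
move=> laurD.
have [p] : exists p : 'I_k * 'I_m -> {poly C}, forall ij, exists d : nat,
    D ij.1 ij.2 = tofrac (p ij) / tofrac 'X^d.
  apply: (fin_all_exists (U := fun=> {poly C})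
    (P := fun ij p => exists d : nat, D ij.1 ij.2 = tofrac p / tofrac 'X^d)).
  by case=> i j; exact: laurD.
move=> /fin_all_exists[e pe].
pose d := (\sum_ij e ij)%N.
exists d, (\matrix_(i, j) (p (i, j) * 'X^(d - e (i, j)))).
apply/matrixP => i j; rewrite !mxE (pe (i, j)) mulrA.
have led : (e (i, j) <= d)%N by rewrite /d (bigD1 (i, j)) ?leq_addr.
apply: (mulIf (_ : tofrac 'X^(e (i, j)) != 0)).
  by rewrite tofrac_eq0 expf_neq0 ?polyX_eq0.
rewrite mulfVK ?tofrac_eq0 ?expf_neq0 ?polyX_eq0//.
by rewrite -!tofracM -mulrA -exprD subnK// mulrC.
Qed.

Lemma horner_continuous (K : numFieldType) (p : {poly K}) :
  continuous (horner p).
Proof.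
move=> x; elim/poly_ind: p => [|p c IH].
  rewrite (_ : horner 0 = fun=> 0); first exact: cst_continuous.
  by apply/funext => y; rewrite horner0.
rewrite (_ : horner _ = fun y => p.[y] * y + c); last first.
  by apply/funext => y; rewrite !hornerE.
exact: (@continuousD _ K^o _ (horner p \* id) (fun=> c) x
  (continuousM IH (fun _ => id)) (@cst_continuous _ _ c x)).
Qed.

(** Polynomials are continuous and the punctured neighbourhoods of a are proper
    filters, so the limit at a is the value at a. *)
Lemma poly_mx_limit (K : numFieldType) m n (Y : 'M[{poly K}]_(m, n))
    (a : K) (Z : 'M[K]_(m, n)) :
  at_pt t Y @[t --> a^'] --> Z -> Z = at_pt a Y.
Proof.
move=> limY; apply/matrixP => i j; rewrite mxE.
have limZ : (Y i j).[t] @[t --> a^'] --> Z i j.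
  have -> : horner (Y i j) = fun t => at_pt t Y i j.
    by apply/funext => t; rewrite mxE.
  exact: cvg_comp limY (@coord_continuous _ _ _ i j Z).
have limh : (Y i j).[t] @[t --> a^'] --> (Y i j).[a].
  apply: cvg_trans (@horner_continuous _ (Y i j) a).
  exact/cvg_app/cvg_within.
exact: (cvg_unique _ limZ limh).
Qed.

(** * Linear combinations with matrix coefficients *)

Lemma mulmx_tr_invmxK (R : comUnitRingType) k m (h : 'M[R]_(k, m))
    (Q : 'M[R]_m) : Q \in unitmx -> h *m (invmx Q)^T *m Q^T = h.
Proof. by move=> uQ; rewrite -mulmxA -trmx_mul mulmxV// trmx1 mulmx1. Qed.

Lemma row_free_mul_scale_tr_invmx (F : fieldType) k m (B : 'M[F]_(k, m))
    (a : F) (Q : 'M[F]_m) :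
  a != 0 -> Q \in unitmx -> row_free B -> row_free (B *m (a *: invmx Q)^T).
Proof.
move=> a0 uQ; rewrite /row_free linearZ /= -scalemxAr mxrank_scale_nz//.
by rewrite mxrankMfree// row_free_unit unitmx_tr unitmx_inv.
Qed.

Lemma mxrank_eq_scale (F : fieldType) m n (a b : F) (A B : 'M[F]_(m, n)) :
  a != 0 -> b != 0 -> a *: A = b *: B -> \rank A = \rank B.
Proof.
by move=> a0 b0 AB; rewrite -(mxrank_scale_nz A a0) AB mxrank_scale_nz.
Qed.

Lemma sum_scale_mulmx (R : nzRingType) (V : lmodType R) k m
    (u : 'rV[R]_k) (A : 'M[R]_(k, m)) (Z : 'I_m -> V) :
  \sum_j (u *m A) 0 j *: Z j = \sum_i u 0 i *: \sum_j A i j *: Z j.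
Proof.
under [RHS]eq_bigr do rewrite scaler_sumr.
rewrite exchange_big /=; apply: eq_bigr => j _.
by rewrite mxE scaler_suml; apply: eq_bigr => i _; rewrite scalerA.
Qed.

Section LinearCombinations.
Variables (F : fieldType) (vT : vectType F).

Definition lincombs k m (A : 'M[F]_(k, m)) (X : m.-tuple vT) : k.-tuple vT :=
  [tuple \sum_(j < m) A i j *: X`_j | i < k].

Lemma sum_lincombs k m (A : 'M[F]_(k, m)) (X : m.-tuple vT) (u : 'rV[F]_k) :
  \sum_i u 0 i *: (lincombs A X)`_i = \sum_j (u *m A) 0 j *: X`_j.
Proof.
by rewrite sum_scale_mulmx; apply: eq_bigr => i _; rewrite nth_mktuple.
Qed.

Lemma free_lincombs k m (A : 'M[F]_(k, m)) (X : m.-tuple vT) :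
  free X -> free (lincombs A X) = row_free A.
Proof.
move=> /freeP freeX; apply/freeP/idP => [freeAX|freeA u uAX0 i].
  apply: inj_row_free => u uA0; apply/rowP => i; rewrite mxE.
  apply: (freeAX (u 0)); rewrite sum_lincombs uA0.
  by rewrite big1// => j _; rewrite mxE scale0r.
pose w : 'rV[F]_k := \row_i u i.
have : w *m A = 0.
  apply/rowP => j; rewrite [RHS]mxE; apply: (freeX ((w *m A) 0)).
  by rewrite -sum_lincombs -[RHS]uAX0; apply: eq_bigr => l _; rewrite mxE.
rewrite -(mul0mx _ A) => /(row_free_inj freeA)/rowP/(_ i).
by rewrite !mxE.
Qed.

End LinearCombinations.

(** * Transporting subspaces along a degeneration *)

Section Degeneration.
Variables (C : numClosedFieldType) (n : nat).
Local Notation K := {fraction {poly C}}.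

Lemma over_frac_sum (I : finType) (p : I -> {poly C})
    (Y : I -> 'M[{poly C}]_n) :
  over_frac (\sum_i p i *: Y i) = \sum_i tofrac (p i) *: over_frac (Y i).
Proof. by rewrite raddf_sum; apply: eq_bigr => i _; rewrite /= map_mxZ. Qed.

Lemma cst_mx_over_frac (Z : 'M[C]_n) : cst_mx Z = over_frac (map_mx polyC Z).
Proof. by rewrite -map_mx_comp. Qed.

Lemma cst_mx_sum (I : finType) (b : I -> C) (Z : I -> 'M[C]_n) :
  cst_mx (\sum_i b i *: Z i) = \sum_i tofrac (b i)%:P *: cst_mx (Z i).
Proof.
rewrite cst_mx_over_frac raddf_sum; under eq_bigr do rewrite /= map_mxZ.
by rewrite over_frac_sum; under [RHS]eq_bigr do rewrite cst_mx_over_frac.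
Qed.

(** Extending scalars from C to C(t) does not increase the maximal rank of V:
    the generic rank of a combination over C[t] is the rank of one of its
    values, and these are elements of V. *)
Lemma mxrank_poly_combination (V : {vspace 'M[C]_n}) k (v : k.-tuple 'M[C]_n)
    (g : 'I_k -> {poly C}) :
  (forall b, v`_b \in V) ->
  (\rank (\sum_b tofrac (g b) *: cst_mx v`_b)%R <= max_rank V)%N.
Proof.
move=> vV; pose G := \sum_b g b *: map_mx polyC v`_b.
have -> : \sum_b tofrac (g b) *: cst_mx v`_b = over_frac G.
  by rewrite over_frac_sum; under eq_bigr do rewrite cst_mx_over_frac.
have [a] := mxrank_horner_generic G; move/leq_trans; apply; apply: max_rank_ub.
rewrite /G raddf_sum memv_suml// => b _; rewrite /= map_mxZ /=.
rewrite -map_mx_comp map_mx_id; first exact: memvZ.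
by move=> c; exact: hornerC.
Qed.

(** V' is the limit of V at t = 0, which exists because the Grassmannian is
    proper; [saturation] is the form that properness takes here. *)
Lemma degenerates_lift m (L L' V : {vspace 'M[C]_n}) :
  degenerates m L L' -> (V <= L)%VS ->
  exists V' : {vspace 'M[C]_n},
    [/\ (V' <= L')%VS, \dim V' = \dim V & (max_rank V' <= max_rank V)%N].
Proof.
move=> [X [X' [bX bX' [P [Q [Y [_ [uQ _ laurQV] YE limY]]]]]]] VL.
set k := \dim V; pose v := vbasis V.
have vV b : v`_b \in V.
  have [bk|bk] := ltnP b k; last by rewrite nth_default ?mem0v ?size_tuple.
  by apply/vbasis_mem/mem_nth; rewrite size_tuple.
have spanX (Z : 'M[C]_n) : Z \in L -> Z = \sum_j coord X j Z *: X`_j.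
  by move=> ZL; apply: coord_span; rewrite (span_basis bX).
(* v = B X, with X the basis of L that enters the degeneration. *)
pose B : 'M[C]_(k, m) := \matrix_(b, j) coord X j v`_b.
have vE (b : 'I_k) : v`_b = \sum_j B b j *: X`_j.
  rewrite {1}(spanX v`_b) ?(subvP VL)//.
  by apply: eq_bigr => j _; rewrite mxE.
have freeB : row_free B.
  rewrite -(free_lincombs _ (basis_free bX)) (_ : lincombs B X = v).
    exact: basis_free (vbasisP V).
  apply: eq_from_tnth => b; rewrite tnth_mktuple -vE (tnth_nth 0) //.
have X'E i : tnth X' i = at_pt 0 (Y i) by exact: poly_mx_limit (limY i).
have [d [R RE]] := laurent_common_denominator laurQV.
have XdK : tofrac 'X^d != 0 :> K by rewrite tofrac_eq0 expf_neq0 ?polyX_eq0.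
(* Since P X P^T = Y Q^-1, with d clearing the denominators of Q^-1, the rows of
   D are the coordinates of the t^d P v_b P^T with respect to Y. *)
pose D := map_mx polyC B *m R^T.
have freeD : row_free (over_frac D).
  rewrite map_mxM /= -map_trmx RE.
  apply: row_free_mul_scale_tr_invmx XdK uQ _.
  by rewrite -map_mx_comp /row_free (mxrank_map (@tofrac {poly C} \o @polyC C)).
have [N [A [E [XE freeE]]]] := saturation freeD.
have XNK : tofrac 'X^N != 0 :> K by rewrite tofrac_eq0 expf_neq0 ?polyX_eq0.
(* V' is spanned by the values at 0 of the combinations of Y given by E. *)
pose Z := lincombs (at_pt 0 E) X'.
have freeZ : free Z by rewrite free_lincombs ?(basis_free bX').
exists <<Z>>%VS; split.
- apply/span_subvP => _ /mapP[a _ ->]; apply: memv_suml => j _.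
  apply/memvZ/(basis_mem bX')/mem_nth; by rewrite size_tuple.
- by rewrite (eqP freeZ) size_tuple.
apply/bigmax_leqP => r /asboolP[M [MZ M0 <-]].
(* The element M of V' is the value at 0 of W, and over C(t) the matrix W is,
   up to powers of t, a combination of the P v_b P^T. *)
pose c := \row_a coord Z a M.
pose W := \sum_i (map_mx polyC c *m E) 0 i *: Y i.
have -> : M = at_pt 0 W.
  have {1}-> : M = \sum_a c 0 a *: Z`_a.
    by rewrite {1}(coord_span MZ); apply: eq_bigr => a _; rewrite mxE.
  rewrite sum_lincombs /W raddf_sum; apply: eq_bigr => i _.
  rewrite /= map_mxZ /= -X'E (tnth_nth 0); congr (_ *: _).
  have cE : at_pt 0 (map_mx polyC c) = c.
    by rewrite -map_mx_comp map_mx_id// => x; exact: hornerC.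
  by rewrite -{1}cE -map_mxM mxE.
apply: leq_trans (mxrank_horner_le _ _) _.
pose g b : {poly C} := (map_mx polyC c *m A) 0 b.
have WE : tofrac 'X^N *: over_frac W =
    tofrac 'X^d *: (P *m (\sum_b tofrac (g b) *: cst_mx v`_b) *m P^T).
  pose h := over_frac (map_mx polyC c *m A *m map_mx polyC B).
  have -> : \sum_b tofrac (g b) *: cst_mx v`_b = \sum_j h 0 j *: cst_mx X`_j.
    rewrite /h map_mxM sum_scale_mulmx; apply: eq_bigr => b _.
    rewrite mxE; congr (_ *: _); rewrite vE cst_mx_sum.
    by apply: eq_bigr => j _; rewrite [in RHS]mxE [in RHS]mxE.
  have DE : map_mx polyC c *m A *m map_mx polyC B *m R^T =
      'X^N *: (map_mx polyC c *m E).
    by rewrite -mulmxA -/D -mulmxA -XE scalemxAr.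
  have hE : tofrac 'X^d *: (h *m (invmx Q)^T) =
      over_frac ('X^N *: (map_mx polyC c *m E)).
    by rewrite -DE map_mxM /= -map_trmx RE linearZ /= scalemxAr.
  (* The body of h is of no further use, and unification would unfold it. *)
  clearbody h.
  have -> : tofrac 'X^N *: over_frac W =
      \sum_i (tofrac 'X^d *: (h *m (invmx Q)^T)) 0 i *: poly_mx (Y i).
    rewrite hE over_frac_sum scaler_sumr; apply: eq_bigr => i _.
    by rewrite scalerA -tofracM [in RHS]mxE [in RHS]mxE.
  under eq_bigr => i _ do rewrite mxE -scalerA YE.
  rewrite -scaler_sumr; congr (_ *: _).
  have hQ : h = h *m (invmx Q)^T *m Q^T.
    exact/esym/(mulmx_tr_invmxK h uQ).
  rewrite [in RHS]hQ.
  rewrite [in RHS]sum_scale_mulmx mulmx_sumr mulmx_suml; apply: eq_bigr => i _.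
  rewrite -scalemxAr -scalemxAl; congr (_ *: _).
  rewrite mulmx_sumr mulmx_suml; apply: eq_bigr => j _.
  by rewrite mxE -scalemxAr -scalemxAl (tnth_nth 0).
rewrite (mxrank_eq_scale XNK XdK WE).
apply: leq_trans (mxrankM_maxl _ _) _.
apply: leq_trans (mxrankM_maxr _ _) _.
exact: mxrank_poly_combination.
Qed.

End Degeneration.

(** * Semicontinuity of tau *)

Theorem proposition6p6 (R : realType) (n m : nat) (L L' : {vspace 'M[R[i]]_n})
    (HL : jordan_space L) (HL' : jordan_space L')
    (dimL : \dim L = m) (dimL' : \dim L' = m)
    (LL' : degenerates m L L') (k : nat) (k_range : (1 <= k <= m)%N) :
  (tau k L' <= tau k L)%N.
Proof.
have [V [VL dimV <-]] : exists V : {vspace 'M[R[i]]_n},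
    [/\ (V <= L)%VS, \dim V = k & max_rank V = tau k L].
  by apply: tau_attained; rewrite dimL; case/andP: k_range.
have [V' [V'L' dimV' rkV']] := degenerates_lift LL' VL.
by apply: leq_trans rkV'; apply: tau_lb => //; rewrite dimV'.
Qed.
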